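(* Let $X$ be a nonempty Borel space, $Q$ a stochastic kernel on $X$, and $\Phi,\Psi\subset X$ Borel measurable sets. Suppose that $$\sup_{x\in\Phi\setminus\Psi}Q(x,\Phi\setminus\Psi)<1 .$$ Then: (1) $L$ is a contraction on $\mathcal M_b^{01}(\Phi,\Psi)$ with respect to $\|\cdot\|_\infty$ (i.e. there is a constant $c<1$ with $\|L[W_1]-L[W_2]\|_\infty\le c\,\|W_1-W_2\|_\infty$ for all $W_1,W_2\in\mathcal M_b^{01}(\Phi,\Psi)$); (2) the equation $$W(x)=\mathbf 1_\Psi(x)+\mathbf 1_{\Phi\setminus\Psi}(x)\int_X Q(x,\mathrm d\xi)\,W(\xi)\quad\text{for all }x\in X$$ has a unique solution $W$ in $\mathcal M_b^{01}(\Phi,\Psi)$, namely $W=V$; (3) the functions $V_k$ converge to $V$ in the norm $\|\cdot\|_\infty$, that is, uniformly on $X$.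
   Context: A Borel space is a Borel subset $X$ of a Polish space, with Borel $\sigma$-algebra $\mathfrak B(X)$; ''measurable'' means Borel measurable. A stochastic kernel on $X$ is a map $Q:X\times\mathfrak B(X)\to[0,1]$ such that $Q(x,\cdot)$ is a probability measure for each $x\in X$ and $Q(\cdot,B)$ is measurable for each $B\in\mathfrak B(X)$. $\mathcal M_b(X)$ is the Banach space of bounded measurable functions $X\to\mathbb R$ with norm $\|f\|_\infty:=\sup_{x\in X}|f(x)|$, and $L:\mathcal M_b(X)\to\mathcal M_b(X)$ is defined by $$L[W](x):=\mathbf 1_\Psi(x)+\mathbf 1_{\Phi\setminus\Psi}(x)\int_X Q(x,\mathrm d\xi)\,W(\xi).$$ $\mathcal M_b^{01}(\Phi,\Psi)\subset\mathcal M_b(X)$ is the set of $W\in\mathcal M_b(X)$ such that $0\le W(x)\le1$ for all $x\in X$, $W(x)=1$ for all $x\in\Psi$, and $W(x)=0$ for all $x\in X\setminus(\Phi\cup\Psi)$; $L$ maps this set into itself. Define $V_0:=\mathbf 1_\Psi$, $V_{k+1}:=L[V_k]$ for $k\ge0$, and $V(x):=\lim_{k\to+\infty}V_k(x)$; the limit exists because, for every $x$, $(V_k(x))_k$ is nondecreasing and bounded by $1$. A supremum over the empty set of values in $[0,1]$ is taken to be $0$. *)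

(* Defs.v *)
(* MathComp / MathComp-Analysis. *)
From HB Require Import structures.
From mathcomp Require Import all_boot all_order all_algebra.
From mathcomp Require Import all_classical all_reals all_analysis.

Set Implicit Arguments.
Unset Strict Implicit.
Unset Printing Implicit Defensive.

Import Order.TTheory GRing.Theory Num.Theory.
Import numFieldNormedType.Exports.

Local Open Scope classical_set_scope.
Local Open Scope ring_scope.

(* The metric is existentially quantified: being Polish is a property of the
   topology.  Nonnegativity of [dist] follows from the other metric axioms. *)
Definition polish_space (R : realType) (E : topologicalType) : Prop :=
  (exists2 S : set E, countable S & dense S) /\
  exists dist : E -> E -> R,
    [/\ (forall x y, dist x y = 0 <-> x = y),
        (forall x y, dist x y = dist y x),
        (forall x y z, dist x z <= dist x y + dist y z),
        (forall (x : E) (U : set E),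
            nbhs x U <-> exists2 e, 0 < e & [set y | dist x y < e] `<=` U) &
        (forall u : nat -> E,
            (forall e, 0 < e -> exists N : nat, forall m n : nat,
                (N <= m)%N -> (N <= n)%N -> dist (u m) (u n) < e) ->
            exists l : E, u @ \oo --> l)].

Definition borel_set (E : topologicalType) (A : set E) : Prop :=
  <<s [set U : set E | open U] >> A.

(* The subset [A] of [E] as a measurable space, with the Borel sigma-algebra of
   its subspace topology.  Measurable types of the library are pointed; the
   parameter [x0] supplies the point, i.e. the nonemptiness of [A], and plays no
   other role. *)
Definition borel_subspace (E : topologicalType) (A : set E) (x0 : A) : Type := A.

Section borel_subspace_instances.
Context {E : topologicalType} {A : set E} (x0 : A).

HB.instance Definition _ := Choice.on (borel_subspace x0).
HB.instance Definition _ := isPointed.Build (borel_subspace x0) x0.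

Definition borel_subspace_open : set (set (borel_subspace x0)) :=
  [set U : set A | open U].

HB.instance Definition _ := Measurable.copy (borel_subspace x0)
  (g_sigma_algebraType borel_subspace_open).

End borel_subspace_instances.

Section reach_avoid.
Context {d : measure_display} {X : measurableType d} {R : realType}.
Implicit Types (Q : R.-pker X ~> X) (Phi Psi : set X) (W : X -> R).

Definition Mb : set (X -> R) :=
  [set W : X -> R | measurable_fun [set: X] W /\ bounded_fun W].

(* A real supremum, hence meaningful for bounded functions only. *)
Definition supnorm W : R := sup [set `|W x| | x in [set: X]].

Definition Mb01 Phi Psi : set (X -> R) :=
  [set W : X -> R | [/\ Mb W,
               (forall x, 0 <= W x <= 1),
               (forall x, Psi x -> W x = 1) &
               (forall x, ~ (Phi `|` Psi) x -> W x = 0)]].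

(* Defined for every real function, but meant on [Mb]. *)
Definition Lop Q Phi Psi W : X -> R := fun x =>
  \1_Psi x + \1_(Phi `\` Psi) x * (\int[Q x]_xi W xi)%R.

Definition Viter Q Phi Psi (k : nat) : X -> R :=
  iter k (Lop Q Phi Psi) \1_Psi.

Definition Vlim Q Phi Psi : X -> R := fun x =>
  limn (fun k => Viter Q Phi Psi k x).

(* [sup set0 = 0], which is the convention wanted when [Phi `\` Psi] is empty. *)
Definition sup_stay Q Phi Psi : R :=
  sup [set fine (Q x (Phi `\` Psi)) | x in Phi `\` Psi].

End reach_avoid.

(* Main.v *)
(* With [S = Phi `\` Psi], two functions of [Mb01] agree off [S], so [L] contracts
   by [c = sup_(x in S) Q(x, S)].  Hence [L^k] brings any two functions of [Mb01]
   within [c^k] of each other.  Comparing [V_(k+n) = L^k V_n] with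
   [V_k = L^k V_0] and letting [n] go to infinity gives [|V_k - V| <= c^k], from
   which everything follows.  The pointwise limit [V] exists because [V_k] is
   nondecreasing in [k]. *)
Require Import Defs.
From mathcomp Require Import all_boot all_order all_algebra.
From mathcomp Require Import all_classical all_reals all_analysis.
From mathcomp Require Import lra measurable_realfun.
Import Order.TTheory GRing.Theory Num.Theory.
Import numFieldNormedType.Exports.
Local Open Scope classical_set_scope.
Local Open Scope ring_scope.

Section reach_avoid_contraction.
Context {d : measure_display} {X : measurableType d} {R : realType}.
Implicit Types (W : X -> R) (x : X).

(** * The sup norm of bounded functions *)

Lemma supnorm_ge W x : bounded_fun W -> `|W x| <= supnorm W.
Proof.
move=> bW; apply: ub_le_sup; last by exists x.
have [M [_ MW]] := bW; exists (M + 1) => _ [y _ <-].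
by apply: (MW (M + 1)) => //; rewrite ltrDl.
Qed.

Lemma bounded_fun_le W M : (forall x, `|W x| <= M) -> bounded_fun W.
Proof.
move=> WM; exists M; split; first exact: num_real.
by move=> N MN x _; exact: le_trans (WM x) (ltW MN).
Qed.

Lemma supnorm_le W M : (forall x, `|W x| <= M) -> supnorm W <= M.
Proof.
move=> WM; apply: ge_sup; first by exists `|W point|; exists point.
by move=> _ [y _ <-].
Qed.

Lemma supnorm_ge0 W : bounded_fun W -> 0 <= supnorm W.
Proof. by move=> /(supnorm_ge W point); exact: le_trans. Qed.

Context (Q : R.-pker X ~> X) (Phi Psi : set X)
  (mPhi : measurable Phi) (mPsi : measurable Psi).

Let mS : measurable (Phi `\` Psi). Proof. exact: measurableD. Qed.

Lemma Mb_integrable x W : Mb W -> (Q x).-integrable setT (EFin \o W).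
Proof.
move=> [mW bW]; apply: measurable_bounded_integrable => //.
by rewrite prob_kernel ltry.
Qed.

Lemma Mb01_Mb W : Mb01 Phi Psi W -> Mb W. Proof. by case. Qed.

Lemma sub_Mb01_le1 W1 W2 x :
  Mb01 Phi Psi W1 -> Mb01 Phi Psi W2 -> `|W1 x - W2 x| <= 1.
Proof.
move=> [_ /(_ x)/andP[? ?] _ _] [_ /(_ x)/andP[? ?] _ _].
by rewrite ler_norml; apply/andP; split; lra.
Qed.

Lemma Mb01B W1 W2 : Mb01 Phi Psi W1 -> Mb01 Phi Psi W2 -> Mb (W1 \- W2).
Proof.
move=> W1S W2S; split; last by apply: bounded_fun_le => x; exact: sub_Mb01_le1.
by case: W1S W2S => [[? _] _ _ _] [[? _] _ _ _]; exact: measurable_funB.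
Qed.

(** * The contraction estimate *)

Lemma fine_ker_le_sup_stay x :
  (Phi `\` Psi) x -> fine (Q x (Phi `\` Psi)) <= sup_stay Q Phi Psi.
Proof.
move=> Sx; apply: ub_le_sup; last by exists x.
(* A real [sup] bounds its set only if the set is bounded above; 1 serves, as [Q y] is a probability
   measure. *)
exists 1 => _ [y _ <-].
have Qy1 : (Q y (Phi `\` Psi) <= 1)%E.
  by rewrite -(prob_kernel (s := Q) y); apply: le_measure; rewrite ?inE.
rewrite -lee_fin fineK// ge0_fin_numE ?measure_ge0//.
exact: le_lt_trans Qy1 (ltry _).
Qed.

Lemma sup_stay_ge0 : 0 <= sup_stay Q Phi Psi.
Proof.
have [S0|/set0P[x Sx]] := eqVneq (Phi `\` Psi) set0.
  by rewrite /sup_stay S0 image_set0 sup0.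
exact: le_trans (fine_ge0 (measure_ge0 _ _)) (fine_ker_le_sup_stay _ Sx).
Qed.

(* [W1 - W2] vanishes off [Phi `\` Psi], so only the mass that [Q x] leaves on
   [Phi `\` Psi] contributes to the integral. *)
Lemma Lop_contract W1 W2 M : Mb01 Phi Psi W1 -> Mb01 Phi Psi W2 ->
    (forall x, `|W1 x - W2 x| <= M) ->
  forall x, `|Lop Q Phi Psi W1 x - Lop Q Phi Psi W2 x| <= sup_stay Q Phi Psi * M.
Proof.
move=> W1S W2S WM x.
(* The sign of [M] matters off [Phi \ Psi], where the left-hand side is 0. *)
have M0 : 0 <= M by exact: le_trans (WM point).
rewrite /Lop opprD addrACA subrr add0r -mulrBr.
have [Sx|nSx] := pselect ((Phi `\` Psi) x); last first.
  by rewrite indicE memNset// mul0r normr0 mulr_ge0// sup_stay_ge0.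
rewrite indicE mem_set// mul1r.
have iW := Mb_integrable x _ (Mb01B _ _ W1S W2S).
rewrite -RintegralB//; [|exact/Mb_integrable/Mb01_Mb..].
apply: le_trans (le_normr_Rintegral _ iW) _ => //.
have -> : (\int[Q x]_t `|(W1 \- W2) t| =
           \int[Q x]_(t in Phi `\` Psi) `|(W1 \- W2) t|)%R.
  rewrite [RHS]Rintegral_mkcond; apply: eq_Rintegral => t _.
  rewrite /patch; case: ifPn => //; rewrite notin_setE => nSt /=.
  (* Off [Phi \ Psi], either both functions are 1 (on [Psi]) or both are 0 (outside the union). *)
  have [Pt|nPt] := pselect (Psi t).
    by case: W1S W2S => [_ _ -> // _] [_ _ -> // _]; rewrite subrr normr0.
  have nt : ~ (Phi `|` Psi) t by case=> // Pht; exact: nSt.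
  by case: W1S W2S => [_ _ _ -> //] [_ _ _ -> //]; rewrite subrr normr0.
apply: le_trans (_ : \int[Q x]_(t in Phi `\` Psi) M <= _).
  apply: le_Rintegral => //.
  - apply: integrableS (integrable_norm iW) => //.
  - apply: measurable_bounded_integrable => //; last exact: bounded_cst.
    apply: le_lt_trans (_ : (Q x setT < +oo)%E); last by rewrite prob_kernel ltry.
    by apply: le_measure; rewrite ?inE.
  - by move=> t _; exact: WM.
by rewrite Rintegral_cst// mulrC ler_wpM2r// fine_ker_le_sup_stay.
Qed.

(** * Invariance of [Mb01] and monotonicity of [L] *)

Lemma Mb01_intro W : measurable_fun setT W -> (forall x, 0 <= W x <= 1) ->
  (forall x, Psi x -> W x = 1) -> (forall x, ~ (Phi `|` Psi) x -> W x = 0) ->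
  Mb01 Phi Psi W.
Proof.
move=> mW W01 W1 W0; split => //; split => //.
apply: (bounded_fun_le _ 1) => x; have /andP[W0x W1x] := W01 x.
by rewrite ger0_norm.
Qed.

Lemma Mb01_indic : Mb01 Phi Psi (\1_Psi : X -> R).
Proof.
apply: Mb01_intro => [|x|x Px|x nx].
- exact: measurable_indic.
- by rewrite indicE; case: (_ \in _); rewrite /= ?lexx ler01.
- by rewrite indicE mem_set.
- by rewrite indicE memNset// => Px; apply: nx; right.
Qed.

Lemma Rintegral_Mb01 x W : Mb01 Phi Psi W -> 0 <= (\int[Q x]_t W t)%R <= 1.
Proof.
move=> WS; have [_ W01 _ _] := WS; apply/andP; split.
  by apply: Rintegral_ge0 => t _; case/andP: (W01 t).
have -> : 1 = (\int[Q x]_t 1)%R :> R.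
  by rewrite Rintegral_cst// prob_kernel/= mulr1.
apply: le_Rintegral => //.
- exact/Mb_integrable/Mb01_Mb.
- apply: (Mb_integrable x (cst 1)); split; first exact: measurable_cst.
  exact: bounded_cst.
- by move=> t _; case/andP: (W01 t).
Qed.

Lemma Lop_Mb01 W : Mb01 Phi Psi W -> Mb01 Phi Psi (Lop Q Phi Psi W).
Proof.
move=> WS; have [[mW _] W01 _ _] := WS.
apply: Mb01_intro => [|x|x Px|x nx]; rewrite /Lop.
- apply: measurable_funD; first exact: measurable_indic.
  apply: measurable_funM; first exact: measurable_indic.
  (* The real integral is [fine] of the extended one, whose measurability in the base point follows
     from that of the kernel, as [W] is nonnegative. *)
  apply: measurableT_comp => //.
  apply: (@measurable_fun_integral_kernel _ _ _ _ _ Q (measurable_kernel Q)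
    (EFin \o W)).
  + by move=> t; rewrite lee_fin; case/andP: (W01 t).
  + exact/measurable_EFinP.
- have /andP[I0 I1] := Rintegral_Mb01 x _ WS; rewrite !indicE.
  (* The two indicators are never both 1, so the value is 1, the integral, or 0. *)
  have [Px|nPx] := pselect (Psi x).
    by rewrite mem_set// memNset ?mul0r ?addr0 ?ler01 ?lexx// => -[].
  rewrite (memNset nPx) add0r; case: (_ \in _); rewrite ?mul1r ?mul0r ?I0 ?I1//.
  by rewrite lexx ler01.
- by rewrite !indicE mem_set// memNset ?mul0r ?addr0// => -[].
- rewrite !indicE memNset; last by move=> ?; apply: nx; right.
  by rewrite memNset ?mul0r ?addr0// => -[? _]; apply: nx; left.
Qed.

Lemma Lop_mono W1 W2 : Mb01 Phi Psi W1 -> Mb01 Phi Psi W2 ->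
    (forall x, W1 x <= W2 x) ->
  forall x, Lop Q Phi Psi W1 x <= Lop Q Phi Psi W2 x.
Proof.
move=> W1S W2S W12 x; rewrite lerD2l ler_wpM2l//.
by apply: le_Rintegral => //; exact/Mb_integrable/Mb01_Mb.
Qed.

(** * The iterates and their pointwise limit *)

Lemma Viter_Mb01 k : Mb01 Phi Psi (Viter Q Phi Psi k).
Proof. by elim: k => [|k IH]; [exact: Mb01_indic|exact: Lop_Mb01]. Qed.

(** [L] adds a nonnegative term to the indicator of [Psi], so [V_0 <= V_1]; monotonicity of [L]
    propagates this. The induction is over all [x] at once because [L] integrates over the whole
    space. *)
Lemma Viter_nondecreasing x : nondecreasing_seq (Viter Q Phi Psi ^~ x).
Proof.
apply/nondecreasing_seqP => k; elim: k x => [|k IH] x.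
  rewrite /Viter/= /Lop lerDl mulr_ge0//.
  by case/andP: (Rintegral_Mb01 x _ Mb01_indic).
exact: Lop_mono (Viter_Mb01 k) (Viter_Mb01 k.+1) IH x.
Qed.

Lemma Viter_cvg x : Viter Q Phi Psi k x @[k --> \oo] --> Vlim Q Phi Psi x.
Proof.
apply: nondecreasing_is_cvgn; first exact: Viter_nondecreasing.
by exists 1 => _ [k _ <-]; have [_ /(_ x)/andP[]] := Viter_Mb01 k.
Qed.

(** Each defining condition of [Mb01] survives pointwise limits of sequences in it. *)
Lemma Vlim_Mb01 : Mb01 Phi Psi (Vlim Q Phi Psi).
Proof.
apply: Mb01_intro => [|x|x Px|x nx].
- apply: (measurable_fun_cvg (h := Viter Q Phi Psi)).
    by move=> k; have [[]] := Viter_Mb01 k.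
  by move=> x _; exact: Viter_cvg.
- apply/andP; split.
    apply: limr_ge; first exact: cvgP (Viter_cvg x).
    by apply: nearW => k; have [_ /(_ x)/andP[]] := Viter_Mb01 k.
  apply: limr_le; first exact: cvgP (Viter_cvg x).
  by apply: nearW => k; have [_ /(_ x)/andP[]] := Viter_Mb01 k.
- apply/cvg_lim => //; apply: cvg_near_cst; apply: nearW => k.
  by have [_ _ ->] := Viter_Mb01 k.
- apply/cvg_lim => //; apply: cvg_near_cst; apply: nearW => k.
  by have [_ _ _ ->] := Viter_Mb01 k.
Qed.

(** * Geometric rate of convergence *)

Lemma iter_Lop_contract k W1 W2 : Mb01 Phi Psi W1 -> Mb01 Phi Psi W2 ->
  forall x, `|iter k (Lop Q Phi Psi) W1 x - iter k (Lop Q Phi Psi) W2 x|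
            <= sup_stay Q Phi Psi ^+ k.
Proof.
move=> W1S W2S; elim: k => [|k IH] x; first exact: sub_Mb01_le1.
rewrite exprS; apply: Lop_contract => //.
  by elim: k {IH} => //= k; exact: Lop_Mb01.
by elim: k {IH} => //= k; exact: Lop_Mb01.
Qed.

Lemma Viter_Vlim_le k x :
  `|Viter Q Phi Psi k x - Vlim Q Phi Psi x| <= sup_stay Q Phi Psi ^+ k.
Proof.
rewrite distrC.
have : `|Viter Q Phi Psi (n + k) x - Viter Q Phi Psi k x| @[n --> \oo] -->
       `|Vlim Q Phi Psi x - Viter Q Phi Psi k x|.
  apply: cvg_norm; apply: cvgB; last exact: cvg_cst.
  by rewrite (cvg_shiftn k (Viter Q Phi Psi ^~ x)); exact: Viter_cvg.
move=> VV; rewrite -(cvg_lim _ VV)//; apply: limr_le; first exact: cvgP VV.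
apply: nearW => n.
(* The sum is commuted so that the [k] outer applications of [L] act on [V_n]. *)
rewrite addnC [Viter _ _ _ (k + n)%N]iterD.
exact: iter_Lop_contract (Viter_Mb01 n) Mb01_indic x.
Qed.

(** * Fixed point and uniform convergence when the rate is below 1 *)

Context (c1 : sup_stay Q Phi Psi < 1).

Let cvg_c : sup_stay Q Phi Psi ^+ k @[k --> \oo] --> (0 : R).
Proof. by apply: cvg_expr; rewrite ger0_norm// sup_stay_ge0. Qed.

(** Pass to the limit in [V_(k+1) = L V_k]: contracting [|V_k - V| <= c^k] once more gives
    [|L V_k - L V| <= c^(k+1)], so no convergence theorem for integrals is used. *)
Lemma Vlim_fixed x : Vlim Q Phi Psi x = Lop Q Phi Psi (Vlim Q Phi Psi) x.
Proof.
suff cvgL : Viter Q Phi Psi k.+1 x @[k --> \oo] --> Lop Q Phi Psi (Vlim Q Phi Psi) x.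
  apply: cvg_lim => //; rewrite -(cvg_shiftS (Viter Q Phi Psi ^~ x)).
  exact: cvgL.
apply/subr_cvg0/norm_cvg0P.
apply: (squeeze_cvgr (f := cst 0) (h := fun k => sup_stay Q Phi Psi ^+ k.+1)).
- apply: nearW => k; rewrite normr_ge0/= exprS; apply: Lop_contract.
  + exact: Viter_Mb01.
  + exact: Vlim_Mb01.
  + exact: Viter_Vlim_le.
- exact: cvg_cst.
- by rewrite (cvg_shiftS (fun k => sup_stay Q Phi Psi ^+ k)).
Qed.

(** A fixed point satisfies [W = L^k W], hence lies within [c^k] of [V_k = L^k V_0] and is the limit
    of the [V_k]. *)
Lemma Lop_fixed_unique W : Mb01 Phi Psi W -> (forall x, W x = Lop Q Phi Psi W x) ->
  W = Vlim Q Phi Psi.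
Proof.
move=> WS WL; apply/funext => x; apply/esym/cvg_lim => //.
apply/subr_cvg0/norm_cvg0P.
apply: (squeeze_cvgr (f := cst 0) (h := fun k => sup_stay Q Phi Psi ^+ k)) => //.
- apply: nearW => k; rewrite normr_ge0/=.
  have -> : W = iter k (Lop Q Phi Psi) W.
    by elim: k => //= k <-; exact/funext.
  exact: iter_Lop_contract Mb01_indic WS x.
- exact: cvg_cst.
Qed.

Lemma Viter_supnorm_cvg :
  supnorm (Viter Q Phi Psi k \- Vlim Q Phi Psi) @[k --> \oo] --> (0 : R).
Proof.
apply: (squeeze_cvgr (f := cst 0) (h := fun k => sup_stay Q Phi Psi ^+ k)) => //.
- apply: nearW => k; apply/andP; split; last exact/supnorm_le/Viter_Vlim_le.
  by apply: supnorm_ge0; case: (Mb01B _ _ (Viter_Mb01 k) Vlim_Mb01).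
- exact: cvg_cst.
Qed.

Lemma Viter_cvg_uniform : {uniform, Viter Q Phi Psi @ \oo --> Vlim Q Phi Psi}.
Proof.
move=> U /=; rewrite uniform_nbhsT => /nbhs_ex[e /= eU].
(* The bound [c^k] does not depend on the point, so one threshold for [k] serves all of them. *)
have /cvgr0Pnorm_lt/(_ e%:num (gt0 e)) := cvg_c.
apply: filterS => k ck; apply: eU => x /=.
rewrite /ball/= distrC; apply: le_lt_trans (Viter_Vlim_le k x) _.
exact: le_lt_trans (ler_norm _) ck.
Qed.

End reach_avoid_contraction.

Theorem proposition7 (R : realType) (E : topologicalType)
    (polishE : polish_space R E) (A : set E) (borelA : borel_set A) (x0 : A)
    (Q : R.-pker (borel_subspace x0) ~> (borel_subspace x0))
    (Phi Psi : set (borel_subspace x0))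
    (mPhi : measurable Phi) (mPsi : measurable Psi)
    (hsup : sup_stay Q Phi Psi < 1) :
  (exists2 c : R, c < 1 &
     forall W1 W2, Mb01 Phi Psi W1 -> Mb01 Phi Psi W2 ->
       supnorm (Lop Q Phi Psi W1 \- Lop Q Phi Psi W2) <=
         c * supnorm (W1 \- W2)) /\
  [/\ Mb01 Phi Psi (Vlim Q Phi Psi),
      (forall x, Vlim Q Phi Psi x =
         \1_Psi x +
         \1_(Phi `\` Psi) x * (\int[Q x]_xi Vlim Q Phi Psi xi)%R) &
      (forall W, Mb01 Phi Psi W ->
         (forall x, W x =
            \1_Psi x + \1_(Phi `\` Psi) x * (\int[Q x]_xi W xi)%R) ->
         W = Vlim Q Phi Psi)] /\
  (supnorm (Viter Q Phi Psi k \- Vlim Q Phi Psi) @[k --> \oo] --> (0 : R) /\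
   {uniform, Viter Q Phi Psi @ \oo --> Vlim Q Phi Psi}).
Proof.
split.
  exists (sup_stay Q Phi Psi) => // W1 W2 W1S W2S; apply: supnorm_le.
  (* The pointwise bound [M] is here the sup norm of the difference, a true bound since the
     difference is bounded. *)
  apply: Lop_contract => // x.
  by apply: (supnorm_ge (W1 \- W2)); case: (Mb01B _ _ _ _ W1S W2S).
split; last first.
  by split; [exact: Viter_supnorm_cvg|exact: Viter_cvg_uniform].
split; first exact: Vlim_Mb01.
  exact: Vlim_fixed.
exact: Lop_fixed_unique.
Qed.
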